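(* Let $A$ be a separable unital $C^*$-algebra. Then $A$ is weakly semiprojective with respect to unital $C^*$-algebras (WSP1) if, and only if, $A$ is weakly semiprojective (WSP).
   Context: Ideals are closed and two-sided. A separable $C^*$-algebra $A$ is weakly semiprojective (WSP) if for every separable $C^*$-algebra $B$, every increasing sequence of ideals $J_1\subseteq J_2\subseteq\cdots$ of $B$ with $J=\overline{\bigcup_n J_n}$, and every $*$-homomorphism $\varphi:A\to B/J$, there is a sequence of $*$-homomorphisms $\psi_n:A\to B/J_n$ such that $\pi_n\circ\psi_n(a)\to\varphi(a)$ in norm for all $a\in A$, where $\pi_n:B/J_n\to B/J$ is the quotient map $\pi_n(b+J_n)=b+J$. A separable $C^*$-algebra $A$ (not necessarily unital) is weakly semiprojective with respect to unital $C^*$-algebras (WSP1) if the same holds whenever $B$ is a unital separable $C^*$-algebra. Even if $A$ has a unit, $\varphi$ and the $\psi_n$ are not required to be unital. *)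

(* Defs.v *)
From HB Require Import structures.
From mathcomp Require Import all_boot all_order all_algebra.
From mathcomp Require Import complex.
From mathcomp Require Import all_classical all_reals all_analysis.
From mathcomp Require Import ring lra.

Set Implicit Arguments.
Unset Strict Implicit.
Unset Printing Implicit Defensive.

Import Order.TTheory GRing.Theory Num.Theory.
Import numFieldNormedType.Exports.

Local Open Scope classical_set_scope.
Local Open Scope ring_scope.
Local Open Scope complex_scope.
Local Open Scope quotient_scope.

Reserved Notation "x *c y" (at level 40, left associativity).

(* C*-algebras here are complex and need not have a unit; scalars and norms live
   in R[i]. MathComp rings are unital, so the product is a new operation. *)
HB.mixin Record Lmodule_isStarAlgebra (R : realType) A
    & GRing.Lmodule R[i] A := {
  cmul : A -> A -> A;
  adj : A -> A;
  cmulA : associative cmul;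
  cmulDl : left_distributive cmul +%R;
  cmulDr : right_distributive cmul +%R;
  cmulZl : forall (c : R[i]) (x y : A), cmul (c *: x) y = c *: cmul x y;
  cmulZr : forall (c : R[i]) (x y : A), cmul x (c *: y) = c *: cmul x y;
  adjK : involutive adj;
  adjD : {morph adj : x y / x + y};
  adjZ : forall (c : R[i]) (x : A), adj (c *: x) = c^* *: adj x;
  adjM : forall x y : A, adj (cmul x y) = cmul (adj y) (adj x)
}.

#[short(type="starAlgType")]
HB.structure Definition StarAlgebra (R : realType) :=
  {A of GRing.Lmodule R[i] A & Lmodule_isStarAlgebra R A}.

Notation "x *c y" := (cmul x y) : ring_scope.

HB.mixin Record StarAlgebra_isCStarAlgebra (R : realType) A
    & StarAlgebra R A & CompleteNormedModule R[i] A := {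
  normcM : forall x y : A, `|x *c y| <= `|x| * `|y|;
  cstar_identity : forall x : A, `|adj x *c x| = `|x| ^+ 2
}.

#[short(type="cstarAlgType")]
HB.structure Definition CStarAlgebra (R : realType) :=
  {A of StarAlgebra R A & CompleteNormedModule R[i] A
   & StarAlgebra_isCStarAlgebra R A}.

Definition star_hom (R : realType) (A B : starAlgType R) (f : A -> B) :=
  [/\ linear f, {morph f : x y / x *c y} & {morph f : x / adj x}].

Definition separable_space (T : topologicalType) :=
  exists2 D : set T, countable D & dense D.

Definition unital (R : realType) (A : starAlgType R) :=
  exists e : A, left_id e (@cmul R A) /\ right_id e (@cmul R A).

(* Closure under adj is not an axiom: it follows, see ideal_adj below. *)
HB.mixin Record isClosedIdeal (R : realType) (A : cstarAlgType R)
    (S : {pred A}) := {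
  idealZ : forall (c : R[i]) (x : A), x \in S -> c *: x \in S;
  idealMl : forall x y : A, y \in S -> x *c y \in S;
  idealMr : forall x y : A, x \in S -> x *c y \in S;
  ideal_closed : closed [set` S]
}.

#[short(type="closedIdeal")]
HB.structure Definition ClosedIdeal (R : realType) (A : cstarAlgType R) :=
  {S of GRing.ZmodClosed A S & isClosedIdeal R A S}.

Section NormTheory.
Variables (R : realType) (A : cstarAlgType R).
Implicit Types (x y z : A) (c : R[i]).

(* The norm as a real number. *)
Definition nrm x : R := complex.Re `|x|.

Lemma nrmE x : `|x| = (nrm x)%:C.
Proof. by rewrite /nrm RRe_real// ger0_real. Qed.

Lemma nrm_ge0 x : 0 <= nrm x.
Proof. by rewrite -ler0c -nrmE. Qed.

Lemma nrmD x y : nrm (x + y) <= nrm x + nrm y.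
Proof. by rewrite -lecR rmorphD /= -!nrmE ler_normD. Qed.

Lemma nrmN x : nrm (- x) = nrm x.
Proof. by rewrite /nrm normrN. Qed.

Lemma nrmB x y : nrm (x - y) <= nrm x + nrm y.
Proof. by rewrite -[nrm y]nrmN nrmD. Qed.

Lemma nrmM x y : nrm (x *c y) <= nrm x * nrm y.
Proof. by rewrite -lecR rmorphM /= -!nrmE normcM. Qed.

Lemma nrmZ c x : nrm (c *: x) = complex.Re `|c| * nrm x.
Proof.
apply: complexI; rewrite -nrmE normrZ rmorphM /= -nrmE; congr (_ * _).
Qed.

Lemma nrmZr (r : R) x : nrm (r%:C *: x) = `|r| * nrm x.
Proof. by rewrite nrmZ normc_def /= expr0n addr0 sqrtr_sqr. Qed.

Lemma nrm_cstar x : nrm (adj x *c x) = nrm x ^+ 2.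
Proof. by apply: complexI; rewrite rmorphXn /= -!nrmE cstar_identity. Qed.

End NormTheory.

Section StarTheory.
Variables (R : realType) (A : starAlgType R).
Implicit Types (x y z : A) (c : R[i]).

Lemma cmul0l x : 0 *c x = 0.
Proof. by rewrite -[X in X *c _](scale0r (0 : A)) cmulZl scale0r. Qed.

Lemma cmul0r x : x *c 0 = 0.
Proof. by rewrite -[X in _ *c X](scale0r (0 : A)) cmulZr scale0r. Qed.

Lemma cmulNl x y : (- x) *c y = - (x *c y).
Proof. by rewrite -[- x]scaleN1r cmulZl scaleN1r. Qed.

Lemma cmulNr x y : x *c (- y) = - (x *c y).
Proof. by rewrite -[- y]scaleN1r cmulZr scaleN1r. Qed.

Lemma cmulBl x y z : (x - y) *c z = x *c z - y *c z.
Proof. by rewrite cmulDl cmulNl. Qed.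

Lemma cmulBr x y z : x *c (y - z) = x *c y - x *c z.
Proof. by rewrite cmulDr cmulNr. Qed.

Lemma cmul_suml (I : Type) (r : seq I) (P : pred I) (F : I -> A) x :
  (\sum_(i <- r | P i) F i) *c x = \sum_(i <- r | P i) F i *c x.
Proof. by apply: (big_morph (fun y => y *c x)) => [y z|]; rewrite ?cmul0l ?cmulDl. Qed.

Lemma cmul_sumr (I : Type) (r : seq I) (P : pred I) (F : I -> A) x :
  x *c (\sum_(i <- r | P i) F i) = \sum_(i <- r | P i) x *c F i.
Proof. by apply: (big_morph (fun y => x *c y)) => [y z|]; rewrite ?cmul0r ?cmulDr. Qed.

Lemma adj0 : adj 0 = 0 :> A.
Proof. by rewrite -[X in adj X](scale0r (0 : A)) adjZ rmorph0 scale0r. Qed.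

Lemma adjN x : adj (- x) = - adj x.
Proof. by apply/eqP; rewrite -addr_eq0 -adjD addNr adj0. Qed.

Lemma adjB x y : adj (x - y) = adj x - adj y.
Proof. by rewrite adjD adjN. Qed.

End StarTheory.

Section CStarTheory.
Variables (R : realType) (A : cstarAlgType R).
Implicit Types (x y z : A) (c : R[i]).

Lemma nrm0 : nrm (0 : A) = 0.
Proof. by rewrite /nrm normr0. Qed.

Lemma nrm_eq0 x : nrm x = 0 -> x = 0.
Proof. by move=> x0; apply: normr0_eq0; rewrite nrmE x0. Qed.

Lemma nrm_adj x : nrm (adj x) = nrm x.
Proof.
suff le_adj y : nrm y <= nrm (adj y).
  by apply/eqP; rewrite eq_le le_adj andbT -{2}[x]adjK le_adj.
have [y0|] := eqVneq (nrm y) 0; first by rewrite y0 nrm_ge0.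
rewrite neq_lt ltNge nrm_ge0 /= => y_gt0.
by rewrite -(ler_pM2r y_gt0) -expr2 -nrm_cstar nrmM.
Qed.

Lemma nrm_cstar' x : nrm (x *c adj x) = nrm x ^+ 2.
Proof. by rewrite -{1}[x]adjK nrm_cstar nrm_adj. Qed.

Lemma nrm_sum (I : Type) (r : seq I) (P : pred I) (F : I -> A) :
  nrm (\sum_(i <- r | P i) F i) <= \sum_(i <- r | P i) nrm (F i).
Proof.
elim/big_ind2 : _ => [|x a y b xa yb|//]; first by rewrite nrm0.
by rewrite (le_trans (nrmD _ _))// lerD.
Qed.

End CStarTheory.

(* An elementary substitute for approximate units. With h = y y^*, the operator
   U = 1 + i s h satisfies |U|^2 <= 1 + s^2 |h|^2 because h is self-adjoint, and
   its average Q = M^-1 (1 + U + ... + U^(M-1)) satisfies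
   i s h Q = M^-1 (U^M - 1). So Q is the identity modulo any ideal containing h,
   has norm close to 1 if s^2 M is small, and makes y small if s M is large. *)
Section Mollifier.
Variables (R : realType) (A : cstarAlgType R) (y : A) (s : R).
Hypothesis s_gt0 : 0 < s.
Implicit Types x z : A.

Local Notation h := (y *c adj y).
Local Notation c := ('i%C * s%:C : R[i]).
Local Notation nu := (nrm h).

Definition moll_step x : A := x + c *: (h *c x).
Local Notation U := moll_step.

Definition moll_sum M x : A := \sum_(k < M) iter k U x.

Let conj_c : Num.conj c = - c.
Proof.
by apply/eqP; rewrite eq_complex /= !(mul0r, mul1r, mulr0, subr0, addr0, oppr0) !eqxx.
Qed.

Let nrm_c x : nrm (c *: x) = s * nrm x.
Proof.
rewrite nrmZ; congr (_ * _); rewrite normc_def /=.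
by rewrite !(mul0r, mul1r, mulr0, subr0, add0r, oppr0) expr0n add0r sqrtr_sqr gtr0_norm.
Qed.

Let c_neq0 : c != 0.
Proof. by rewrite eq_complex /= !(mul0r, mul1r, add0r, mulr0) (gt_eqF s_gt0) andbF. Qed.

Let adj_h : adj h = h.
Proof. by rewrite adjM adjK. Qed.

Lemma moll_stepD x z : U (x + z) = U x + U z.
Proof. by rewrite /U cmulDr scalerDr addrACA. Qed.

Lemma moll_stepZ a x : U (a *: x) = a *: U x.
Proof. by rewrite /U cmulZr scalerDr !scalerA mulrC. Qed.

Lemma moll_stepM x z : U (x *c z) = U x *c z.
Proof. by rewrite /U cmulDl cmulZl cmulA. Qed.

Lemma iter_stepD k x z : iter k U (x + z) = iter k U x + iter k U z.
Proof. by elim: k => //= k ->; rewrite moll_stepD. Qed.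

Lemma iter_stepZ k a x : iter k U (a *: x) = a *: iter k U x.
Proof. by elim: k => //= k ->; rewrite moll_stepZ. Qed.

Lemma iter_stepM k x z : iter k U (x *c z) = iter k U x *c z.
Proof. by elim: k => //= k ->; rewrite moll_stepM. Qed.

Lemma nrm_step x : nrm (U x) ^+ 2 <= (1 + s ^+ 2 * nu ^+ 2) * nrm x ^+ 2.
Proof.
have -> : nrm (U x) ^+ 2 = nrm (adj x *c x + (s ^+ 2)%:C *: (adj (h *c x) *c (h *c x))).
  rewrite -nrm_cstar /U; congr nrm.
  have wx : adj (h *c x) *c x = adj x *c (h *c x) by rewrite adjM adj_h -cmulA.
  move: (h *c x) wx => w wx.
  have cc : c * c = - (s ^+ 2)%:C.
    by rewrite mulrACA -expr2 sqr_i mulN1r -rmorphM.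
  rewrite adjD adjZ conj_c cmulDl !cmulDr !cmulZl !cmulZr wx scalerA mulNr cc.
  by rewrite opprK addrA scaleNr addrK.
rewrite (le_trans (nrmD _ _))// nrmZr ger0_norm ?sqr_ge0// !nrm_cstar.
rewrite mulrDl mul1r lerD2l -mulrA ler_wpM2l ?sqr_ge0// -exprMn.
by rewrite ler_sqr ?nnegrE ?nrm_ge0 ?mulr_ge0 ?nrm_ge0 ?nrmM.
Qed.

Lemma nrm_iter k x :
  nrm (iter k U x) ^+ 2 <= (1 + s ^+ 2 * nu ^+ 2) ^+ k * nrm x ^+ 2.
Proof.
elim: k => [|k IH]; first by rewrite mul1r.
rewrite iterS (le_trans (nrm_step _))// [_ ^+ k.+1]exprS -[leRHS]mulrA ler_wpM2l//.
by rewrite addr_ge0// mulr_ge0 ?sqr_ge0.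
Qed.

Variables (M : nat) (K : R).
Hypotheses (M_gt0 : (0 < M)%N) (K_ge0 : 0 <= K).
Hypothesis K_bound : (1 + s ^+ 2 * nu ^+ 2) ^+ M <= K ^+ 2.

Lemma nrm_iter_le k x : (k <= M)%N -> nrm (iter k U x) <= K * nrm x.
Proof.
move=> kM; rewrite -ler_sqr ?nnegrE ?mulr_ge0 ?nrm_ge0//.
rewrite (le_trans (nrm_iter _ _))// exprMn ler_wpM2r ?sqr_ge0//.
rewrite (le_trans _ K_bound)// ler_weXn2l// lerDl mulr_ge0 ?sqr_ge0//.
Qed.

Definition moll x : A := (M%:R^-1 : R)%:C *: moll_sum M x.

Lemma mollD x z : moll (x + z) = moll x + moll z.
Proof.
rewrite /moll -scalerDr -big_split /=; congr (_ *: _).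
by apply: eq_bigr => i _; rewrite iter_stepD.
Qed.

Lemma mollM x z : moll (x *c z) = moll x *c z.
Proof.
rewrite /moll cmulZl cmul_suml; congr (_ *: _).
by apply: eq_bigr => i _; rewrite iter_stepM.
Qed.

Lemma nrm_moll x : nrm (moll x) <= K * nrm x.
Proof.
rewrite nrmZr ger0_norm ?invr_ge0// ler_pdivrMl ?ltr0n//.
rewrite (le_trans (nrm_sum _ _ _))//.
rewrite (@le_trans _ _ (\sum_(i < M) (K * nrm x)))//.
  by apply: ler_sum => i _; apply: nrm_iter_le; apply: ltnW.
by rewrite sumr_const card_ord mulr_natl.
Qed.

Lemma sum_step_h x : c *: (moll_sum M h *c x) = iter M U x - x.
Proof.
rewrite cmul_suml scaler_sumr.
rewrite -(telescope_sumr (fun k => iter k U x) (leq0n M)) big_mkord.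
apply: eq_bigr => k _.
rewrite -iter_stepM -iter_stepZ iterSr.
have -> : U x = x + c *: (h *c x) by [].
by rewrite iter_stepD addrAC subrr add0r.
Qed.

Lemma nrm_moll_h : nrm (moll h) <= (K + 1) / (M%:R * s).
Proof.
set S := moll_sum M h.
have nS : s * nrm S <= K + 1.
  have [S0|S_neq0] := eqVneq (nrm (adj S)) 0.
    by rewrite -nrm_adj S0 mulr0 addr_ge0.
  have S_gt0 : 0 < nrm (adj S) by rewrite lt_neqAle eq_sym S_neq0 nrm_ge0.
  rewrite -(ler_pM2r S_gt0) {1}nrm_adj -mulrA -expr2 -nrm_cstar' -nrm_c.
  rewrite sum_step_h (le_trans (nrmB _ _))// mulrDl mul1r lerD2r.
  exact: nrm_iter_le.
rewrite nrmZr ger0_norm ?invr_ge0// invfM [leRHS]mulrC -[leRHS]mulrA.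
rewrite ler_wpM2l ?invr_ge0// mulrC ler_pdivlMr// mulrC//.
Qed.

Lemma nrm_moll_y : nrm (moll y) ^+ 2 <= K * ((K + 1) / (M%:R * s)).
Proof.
rewrite -nrm_cstar' -mollM (le_trans (nrm_moll _))// ler_wpM2l//.
by rewrite -nrm_adj adjM adjK -mollM nrm_moll_h.
Qed.

Lemma moll_ideal (J : closedIdeal A) : h \in J -> forall x, x - moll x \in J.
Proof.
move=> Jh x; have J0 : (0 : A) \in J by exact: rpred0.
have JU k : (x - iter k U x) \in J.
  elim: k => [|k IH]; first by rewrite subrr.
  rewrite iterS /U opprD addrA rpredB//.
  by apply: idealZ; apply: idealMr.
have -> : x - moll x = (M%:R^-1 : R)%:C *: \sum_(k < M) (x - iter k U x).
  rewrite sumrB scalerBr sumr_const card_ord; congr (_ - _).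
  rewrite -(scaler_nat M x) scalerA -[X in _ * X](rmorph_nat (real_complex R)) -rmorphM.
  by rewrite mulVf ?scale1r// pnatr_eq0 -lt0n.
by apply: idealZ; apply: rpred_sum => k _; exact: JU.
Qed.

End Mollifier.

Lemma bernoulli_ub (R : realType) (x : R) M : 0 <= x ->
  (1 + x) ^+ M * (1 - M%:R * x) <= 1.
Proof.
move=> x0; elim: M => [|M IH]; first by rewrite mul0r subr0 mulr1.
rewrite (le_trans _ IH)// exprS mulrAC mulrC ler_wpM2l ?exprn_ge0 ?addr_ge0//.
rewrite -natr1; have : 0 <= M%:R :> R by []; nra.
Qed.

Section ClosedIdealTheory.
Variables (R : realType) (A : cstarAlgType R) (J : closedIdeal A).
Implicit Types x y z : A.

Lemma ideal_mollifier y (k e : R) : y *c adj y \in J -> 1 < k -> 0 < e ->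
  exists Q : A -> A,
    [/\ {morph Q : x z / x + z}, forall x z, Q (x *c z) = Q x *c z,
        forall x, nrm (Q x) <= k * nrm x, forall x, x - Q x \in J
      & nrm (Q y) <= e].
Proof.
move=> Jy k1 e0; set nu := nrm (y *c adj y).
have nu0 : 0 <= nu := nrm_ge0 _.
have k0 : 0 < k by rewrite (lt_trans _ k1).
pose d := 1 - k^-1.
have d0 : 0 < d by rewrite subr_gt0 invf_lt1.
have [eta eta0 etanu] : exists2 eta : R, 0 < eta & eta * nu <= d.
  have nu1 : 0 < 1 + nu by rewrite ltr_wpDr.
  exists (d / (1 + nu)); first by rewrite divr_gt0.
  by rewrite -mulrA ger_pMr// mulrC ler_pdivrMr// mul1r lerDr.
pose N := (Num.truncn (k * (k + 1) / (eta * e ^+ 2))).+1.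
have N0 : 0 < N%:R :> R by rewrite ltr0n.
have Nle : k * (k + 1) / (N%:R * eta) <= e ^+ 2.
  have : k * (k + 1) / (eta * e ^+ 2) <= N%:R by rewrite ltW// truncnS_gt.
  rewrite !ler_pdivrMr ?mulr_gt0 ?exprn_gt0//.
  by have -> : N%:R * (eta * e ^+ 2) = e ^+ 2 * (N%:R * eta) by ring.
pose s := eta / N%:R.
have s0 : 0 < s by rewrite divr_gt0.
have Kb : (1 + s ^+ 2 * nu ^+ 2) ^+ (N ^ 2) <= k ^+ 2.
  set x := s ^+ 2 * nu ^+ 2.
  have x0 : 0 <= x by rewrite mulr_ge0 ?sqr_ge0.
  have Mx : (N ^ 2)%:R * x <= d ^+ 2.
    have -> : (N ^ 2)%:R * x = (eta * nu) ^+ 2.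
      by rewrite /x /s natrX; field; rewrite gt_eqF.
    by rewrite ler_sqr ?nnegrE ?(ltW d0)// mulr_ge0// ltW.
  have kd : 1 <= k ^+ 2 * (1 - d ^+ 2).
    have -> : k ^+ 2 * (1 - d ^+ 2) = 2 * k - 1.
      by rewrite /d; field; rewrite gt_eqF.
    lra.
  have d1 : 0 < 1 - d ^+ 2.
    by rewrite -(pmulr_rgt0 _ (exprn_gt0 2 k0)) (lt_le_trans _ kd).
  rewrite -(ler_pM2r d1). apply: (le_trans _ kd).
  rewrite (le_trans _ (bernoulli_ub (N ^ 2) x0))//.
  by rewrite ler_wpM2l ?exprn_ge0 ?addr_ge0// lerD2l lerN2.
have M0 : (0 < N ^ 2)%N by rewrite expn_gt0.
exists (moll y s (N ^ 2)); split.
- by move=> x z; exact: mollD.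
- by move=> x z; exact: mollM.
- exact: (nrm_moll M0 (ltW k0) Kb).
- exact: (moll_ideal s M0 Jy).
- rewrite -ler_sqr ?nnegrE ?nrm_ge0 ?(ltW e0)//.
  rewrite (le_trans (nrm_moll_y s0 M0 (ltW k0) Kb))//.
  have -> : (N ^ 2)%:R * s = N%:R * eta.
    by rewrite /s natrX; field; rewrite gt_eqF.
  by rewrite mulrA.
Qed.

Lemma ideal_near x : (forall e : R, 0 < e -> exists2 z, z \in J & nrm (x - z) <= e) ->
  x \in J.
Proof.
move=> Jx; suff : [set` J] x by [].
apply: (@ideal_closed _ _ J).
move=> B /nbhs_ballP[e /= e0 xB].
have eE : e = (complex.Re e)%:C by rewrite RRe_real// gtr0_real.
have e'0 : 0 < complex.Re e / 2 by rewrite divr_gt0// -ltcR -eE.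
have [z Jz xz] := Jx _ e'0; exists z; split=> //; apply: xB.
rewrite -ball_normE /= nrmE eE ltcR (le_lt_trans xz)//.
by rewrite ltr_pdivrMr// ltr_pMr ?ltr1n// -ltcR -eE.
Qed.

Lemma ideal_adj x : x \in J -> adj x \in J.
Proof.
move=> Jx; apply: ideal_near => e e0.
have Jh : adj x *c adj (adj x) \in J by rewrite adjK; exact: idealMl.
have [Q [_ _ _ QJ Qe]] := ideal_mollifier Jh (ltr1n R 2) e0.
by exists (adj x - Q (adj x)); rewrite ?QJ// subKr.
Qed.

End ClosedIdealTheory.

Lemma mollifier_estimate (R : realType) (t d : R) : 0 <= t -> 0 < d -> d <= 1 ->
  (1 + d) * ((1 + d) * (t + d) + d) <= t + d * (4 * t + 6).
Proof.
move=> t0 d0 d1.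
have dd : d * d <= d by rewrite ger_pMl.
have ddt : d * d * t <= d * t by rewrite ler_wpM2r.
have ddd : d * d * d <= d by rewrite (le_trans _ dd)// ger_pMr ?mulr_gt0.
have dt : 0 <= d * t by rewrite mulr_ge0// ltW.
nra.
Qed.

Definition cstar_quot (R : realType) (A : cstarAlgType R) (J : closedIdeal A) :=
  {ideal_quot J}.

Section QuotientAlgebra.
Variables (R : realType) (A : cstarAlgType R) (J : closedIdeal A).
Implicit Types (a b : A) (c : R[i]).
Local Notation Q := (cstar_quot J).

HB.instance Definition _ := Choice.on Q.
HB.instance Definition _ := GRing.Zmodule.on Q.
HB.instance Definition _ := EqQuotient.on Q.
HB.instance Definition _ := ZmodQuotient.on Q.

Definition qpi a : Q := \pi_Q a.

Lemma qpi_eq a b : (qpi a = qpi b) <-> a - b \in J.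
Proof.
by split; [move=> ab; rewrite Quotient.idealrBE; apply/eqP
          |move=> ab; apply/eqP; rewrite -Quotient.idealrBE].
Qed.

Lemma qpi_repr (x : Q) : qpi (repr x) = x.
Proof. exact: reprK. Qed.

Lemma qpiW (P : Q -> Prop) : (forall a, P (qpi a)) -> forall x, P x.
Proof. by move=> Pa x; rewrite -(qpi_repr x). Qed.

Lemma repr_qpi a : repr (qpi a) - a \in J.
Proof. by apply/qpi_eq; rewrite qpi_repr. Qed.

Lemma qpiD : {morph qpi : a b / a + b}.
Proof. by move=> a b; rewrite /qpi piE. Qed.

Lemma qpiN : {morph qpi : a / - a}.
Proof. by move=> a; rewrite /qpi piE. Qed.

Lemma qpi0 : qpi 0 = 0.
Proof. by rewrite /qpi piE. Qed.

Lemma qpiB : {morph qpi : a b / a - b}.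
Proof. by move=> a b; rewrite qpiD qpiN. Qed.

Definition qscale c (x : Q) : Q := qpi (c *: repr x).
Definition qmul (x y : Q) : Q := qpi (repr x *c repr y).
Definition qadj (x : Q) : Q := qpi (adj (repr x)).

Lemma qpiZ c a : qscale c (qpi a) = qpi (c *: a).
Proof. by apply/qpi_eq; rewrite -scalerBr idealZ ?repr_qpi. Qed.

Lemma qpiM a b : qmul (qpi a) (qpi b) = qpi (a *c b).
Proof.
apply/qpi_eq; rewrite -[X in X - _](subrK (a *c repr (qpi b))) -cmulBl.
rewrite -addrA -cmulBr rpredD//; first by apply: idealMr; exact: repr_qpi.
by apply: idealMl; exact: repr_qpi.
Qed.

Lemma qpi_adj a : qadj (qpi a) = qpi (adj a).
Proof. by apply/qpi_eq; rewrite -adjB ideal_adj ?repr_qpi. Qed.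

Let qscaleA c d x : qscale c (qscale d x) = qscale (c * d) x.
Proof. by elim/qpiW: x => a; rewrite !qpiZ scalerA. Qed.

Let qscale1 : left_id 1 qscale.
Proof. by elim/qpiW => a; rewrite qpiZ scale1r. Qed.

Let qscaleDr : right_distributive qscale +%R.
Proof.
by move=> c; elim/qpiW => a; elim/qpiW => b; rewrite -qpiD !qpiZ -qpiD scalerDr.
Qed.

Let qscaleDl x : {morph qscale^~ x : c d / c + d}.
Proof. by elim/qpiW: x => a c d; rewrite !qpiZ scalerDl qpiD. Qed.

HB.instance Definition _ := GRing.Zmodule_isLmodule.Build R[i] Q
  qscaleA qscale1 qscaleDr qscaleDl.

Let scale_qpi c a : c *: qpi a = qpi (c *: a).
Proof. exact: qpiZ. Qed.

Let qmulA : associative qmul.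
Proof.
by elim/qpiW => a; elim/qpiW => b; elim/qpiW => d; rewrite !qpiM cmulA.
Qed.

Let qmulDl : left_distributive qmul +%R.
Proof.
elim/qpiW => a; elim/qpiW => b; elim/qpiW => d.
by rewrite !(qpiM, =^~ qpiD) cmulDl.
Qed.

Let qmulDr : right_distributive qmul +%R.
Proof.
elim/qpiW => a; elim/qpiW => b; elim/qpiW => d.
by rewrite !(qpiM, =^~ qpiD) cmulDr.
Qed.

Let qmulZl c (x y : Q) : qmul (c *: x) y = c *: qmul x y.
Proof.
by elim/qpiW: x => a; elim/qpiW: y => b; rewrite !(qpiM, scale_qpi) cmulZl.
Qed.

Let qmulZr c (x y : Q) : qmul x (c *: y) = c *: qmul x y.
Proof.
by elim/qpiW: x => a; elim/qpiW: y => b; rewrite !(qpiM, scale_qpi) cmulZr.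
Qed.

Let qadjK : involutive qadj.
Proof. by elim/qpiW => a; rewrite !qpi_adj adjK. Qed.

Let qadjD : {morph qadj : x y / x + y}.
Proof. by elim/qpiW => a; elim/qpiW => b; rewrite !(qpi_adj, =^~ qpiD) adjD. Qed.

Let qadjZ c (x : Q) : qadj (c *: x) = Num.conj c *: qadj x.
Proof. by elim/qpiW: x => a; rewrite !(scale_qpi, qpi_adj) adjZ. Qed.

Let qadjM (x y : Q) : qadj (qmul x y) = qmul (qadj y) (qadj x).
Proof.
by elim/qpiW: x => a; elim/qpiW: y => b; rewrite !(qpiM, qpi_adj) adjM.
Qed.

HB.instance Definition _ := Lmodule_isStarAlgebra.Build R Q
  qmulA qmulDl qmulDr qmulZl qmulZr qadjK qadjD qadjZ qadjM.

Lemma cmul_qpi a b : qpi a *c qpi b = qpi (a *c b).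
Proof. exact: qpiM. Qed.

Lemma adj_qpi a : adj (qpi a) = qpi (adj a).
Proof. exact: qpi_adj. Qed.

Lemma qpi_star_hom : star_hom qpi.
Proof.
split=> [c a b|a b|a]; first by rewrite qpiD scale_qpi.
- by rewrite cmul_qpi.
- by rewrite adj_qpi.
Qed.

Definition qnrm (x : Q) : R := inf [set nrm a | a in [set a | qpi a = x]].

Let qnrm_has_inf x : has_inf [set nrm a | a in [set a | qpi a = x]].
Proof.
split; first by exists (nrm (repr x)), (repr x) => //=; rewrite qpi_repr.
by exists 0 => _ [a _ <-]; exact: nrm_ge0.
Qed.

Lemma qnrm_le a : qnrm (qpi a) <= nrm a.
Proof. by apply: ge_inf; [case: (qnrm_has_inf (qpi a))|exists a]. Qed.

Lemma qnrm_lt (x : Q) (r : R) : qnrm x < r -> exists2 a, qpi a = x & nrm a < r.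
Proof.
move=> xr; have r0 : 0 < r - qnrm x by rewrite subr_gt0.
have [_ [a /= ax <-] ar] := inf_adherent r0 (qnrm_has_inf x).
by exists a; rewrite // (lt_le_trans ar)// addrC subrK.
Qed.

Lemma qnrm_ge0 x : 0 <= qnrm x.
Proof.
apply: lb_le_inf; first by case: (qnrm_has_inf x).
by move=> _ [a _ <-]; exact: nrm_ge0.
Qed.

Lemma qnrmP (x : Q) (r : R) :
  (forall e, 0 < e -> exists2 a, qpi a = x & nrm a <= r + e) -> qnrm x <= r.
Proof.
move=> xr; apply/ler_addgt0Pr => e /xr[a <- ar].
exact: le_trans (qnrm_le a) ar.
Qed.

Lemma qnrm_near (x : Q) (e : R) : 0 < e -> exists2 a, qpi a = x & nrm a <= qnrm x + e.
Proof.
move=> e0; have [|a ax /ltW ar] := @qnrm_lt x (qnrm x + e); first by rewrite ltrDl.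
by exists a.
Qed.

Lemma qnrmD (x y : Q) : qnrm (x + y) <= qnrm x + qnrm y.
Proof.
apply: qnrmP => e e0; have e2 : 0 < e / 2 by rewrite divr_gt0.
have [[a ax ha] [b by_ hb]] := (qnrm_near x e2, qnrm_near y e2).
exists (a + b); first by rewrite qpiD ax by_.
rewrite (le_trans (nrmD _ _))// (le_trans (lerD ha hb))//.
by rewrite addrACA -splitr.
Qed.

Let qnrmZ_le c (x : Q) : qnrm (c *: x) <= complex.Re `|c| * qnrm x.
Proof.
have [->|c0] := eqVneq c 0.
  rewrite scale0r normr0 /= mul0r -qpi0.
  by rewrite (le_trans (qnrm_le _))// nrm0.
have n0 : 0 < complex.Re `|c|.
  by rewrite -ltcR RRe_real ?normr_real ?normr_gt0.
apply: qnrmP => e e0; have [a ax ha] := qnrm_near x (divr_gt0 e0 n0).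
exists (c *: a); first by rewrite -qpiZ ax.
by rewrite nrmZ -ler_pdivlMl// mulrDr mulKf ?gt_eqF// [_^-1 * e]mulrC.
Qed.

Lemma qnrmZ c (x : Q) : (qnrm (c *: x))%:C = `|c| * (qnrm x)%:C.
Proof.
have -> : `|c| = (complex.Re `|c|)%:C by rewrite RRe_real ?normr_real.
rewrite -rmorphM; congr _%:C; apply/eqP; rewrite eq_le qnrmZ_le andTb.
have [->|c0] := eqVneq c 0; first by rewrite normr0 mul0r qnrm_ge0.
have n0 : 0 < complex.Re `|c|.
  by rewrite -ltcR RRe_real ?normr_real ?normr_gt0.
rewrite -ler_pdivlMl// -{1}[x](scalerK c0) (le_trans (qnrmZ_le _ _))//.
rewrite ler_wpM2r ?qnrm_ge0// normfV -lecR fmorphV.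
by rewrite !RRe_real ?realV ?normr_real.
Qed.

Lemma qnrm_eq0 (x : Q) : qnrm x = 0 -> x = 0.
Proof.
elim/qpiW: x => a qa; rewrite -qpi0; apply/qpi_eq; rewrite subr0.
apply: ideal_near => e e0; have [b ba hb] := qnrm_near (qpi a) e0.
exists (a - b); last by rewrite subKr -[e]add0r -qa.
exact/qpi_eq.
Qed.

Let qnormD (x y : Q) : (qnrm (x + y))%:C <= (qnrm x)%:C + (qnrm y)%:C.
Proof. by rewrite -rmorphD lecR qnrmD. Qed.

Let qnorm_eq0 (x : Q) : (qnrm x)%:C = 0 -> x = 0.
Proof. by move=> /(@complexI R _ 0) /qnrm_eq0. Qed.

HB.instance Definition _ := @Lmodule_isNormed.Build R[i] Q
  (fun x => (qnrm x)%:C) qnormD qnrmZ qnorm_eq0.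

Lemma qnormE (x : Q) : `|x| = (qnrm x)%:C.
Proof. by []. Qed.

Lemma qnrmM (x y : Q) : qnrm (x *c y) <= qnrm x * qnrm y.
Proof.
have le_nrm a b : qnrm (qpi a *c qpi b) <= nrm a * nrm b.
  by rewrite cmul_qpi (le_trans (qnrm_le _))// nrmM.
apply/ler_addgt0Pr => e e0.
set s := qnrm x + qnrm y + 1.
have s0 : 0 < s by rewrite ltr_wpDl// addr_ge0// qnrm_ge0.
pose d := Num.min 1 (e / s).
have d0 : 0 < d by rewrite lt_min ltr01 divr_gt0.
have [[a ax ha] [b by_ hb]] := (qnrm_near x d0, qnrm_near y d0).
apply: (@le_trans _ _ (nrm a * nrm b)); first by rewrite -ax -by_.
rewrite (le_trans (ler_pM (nrm_ge0 _) (nrm_ge0 _) ha hb))//.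
have -> : (qnrm x + d) * (qnrm y + d) =
  qnrm x * qnrm y + d * (qnrm x + qnrm y + d) by ring.
rewrite lerD2l (@le_trans _ _ (d * s))//.
  by rewrite ler_pM2l// lerD2l ge_min lexx.
by rewrite -ler_pdivlMr// ge_min lexx orbT.
Qed.

Lemma qnrm_adj (x : Q) : qnrm (adj x) = qnrm x.
Proof.
suff le_adj y : qnrm (adj y) <= qnrm y.
  by apply/eqP; rewrite eq_le le_adj -{1}[x]adjK le_adj.
apply: qnrmP => e e0; have [a <- ha] := qnrm_near y e0.
by exists (adj a); rewrite ?nrm_adj// adj_qpi.
Qed.

Lemma qnrm_cstar' (x : Q) : qnrm x ^+ 2 <= qnrm (x *c adj x).
Proof.
elim/qpiW: x => b.
have -> : qpi b *c adj (qpi b) = qpi (b *c adj b).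
  by rewrite adj_qpi cmul_qpi.
apply/ler_addgt0Pr => e e0; set t := qnrm (qpi (b *c adj b)).
have t0 : 0 <= t := qnrm_ge0 _.
pose d := Num.min 1 (e / (4 * t + 6)).
have t60 : 0 < 4 * t + 6 by rewrite ltr_wpDl// mulr_ge0.
have d0 : 0 < d by rewrite lt_min ltr01 divr_gt0.
have [w wb wt] := qnrm_near (qpi (b *c adj b)) d0.
have Jj : b *c adj b - w \in J by apply/qpi_eq.
set j := b *c adj b - w in Jj.
have jE : b *c adj b = w + j by rewrite addrC subrK.
have k1 : 1 < 1 + d by rewrite ltrDl.
have [P [PD PM Pn PJ Pj]] := ideal_mollifier (idealMr _ (adj j) Jj) k1 d0.
have -> : qpi b = qpi (P b) by apply/qpi_eq.
have P_bound : nrm (P b) ^+ 2 <= (1 + d) * ((1 + d) * (t + d) + d).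
  rewrite -nrm_cstar' -PM (le_trans (Pn _))// ler_pM2l ?(lt_trans _ k1)//.
  rewrite -nrm_adj adjM adjK -PM jE PD (le_trans (nrmD _ _))// lerD//.
  by rewrite (le_trans (Pn _))// ler_pM2l ?(lt_trans _ k1).
apply: le_trans (_ : nrm (P b) ^+ 2 <= _).
  by rewrite ler_sqr ?nnegrE ?nrm_ge0 ?qnrm_ge0 ?qnrm_le.
apply: (le_trans P_bound).
have d1 : d <= 1 by rewrite ge_min lexx.
have de : d * (4 * t + 6) <= e by rewrite -ler_pdivlMr// ge_min lexx orbT.
apply: (@le_trans _ _ (t + d * (4 * t + 6))); last by rewrite lerD2l.
exact: mollifier_estimate.
Qed.

Lemma quot_normcM (x y : Q) : `|x *c y| <= `|x| * `|y|.
Proof. by rewrite !qnormE -rmorphM lecR qnrmM. Qed.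

Lemma quot_cstar_identity (x : Q) : `|adj x *c x| = `|x| ^+ 2.
Proof.
rewrite !qnormE -rmorphXn; congr _%:C; apply/eqP; rewrite eq_le.
rewrite (le_trans (qnrmM _ _)) ?qnrm_adj ?expr2//=.
by have := qnrm_cstar' (adj x); rewrite adjK qnrm_adj expr2.
Qed.

End QuotientAlgebra.

Section QuotientComplete.
Variables (R : realType) (A : cstarAlgType R) (J : closedIdeal A).
Local Notation Q := (cstar_quot J).
Let e n : R := 2^-1 ^+ n.

Let e_gt0 n : 0 < e n. Proof. by rewrite exprn_gt0. Qed.

Let eS n : e n.+1 + e n.+1 = e n.
Proof. by rewrite /e exprSr -splitr. Qed.

Let e_small (r : R) : 0 < r -> exists n, forall m, (n <= m)%N -> e m < r.
Proof.
move=> r0; have [n _ Hn] := near_infty_natSinv_expn_lt (PosNum r0).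
by exists n => m /Hn /=; rewrite /e exprVn div1r.
Qed.

Let ball_nrm (x y : A) (r : R) : ball x r%:C y = (nrm (x - y) < r) :> Prop.
Proof. by rewrite -ball_normE /= nrmE ltcR. Qed.

Let ball_qnrm (x y : Q) (r : R) : ball x r%:C y = (qnrm (x - y) < r) :> Prop.
Proof. by rewrite -ball_normE /= qnormE ltcR. Qed.

Let realE (r : R[i]) : 0 < r -> exists2 s : R, 0 < s & r = s%:C.
Proof.
move=> r0; have rE : r = (complex.Re r)%:C by rewrite RRe_real// gtr0_real.
by exists (complex.Re r) => //; rewrite -ltcR -rE.
Qed.

Lemma cstar_quot_complete (F : set_system Q) :
  ProperFilter F -> cauchy F -> cvg F.
Proof.
move=> FF /cauchyP Fc.
have /(_ _)/cid-/all_sig[x Fx] n : exists x : Q, F (ball x (e n)%:C).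
  by apply: Fc; rewrite ltcR.
have x_step n : qnrm (x n.+1 - x n) < 2 * e n.
  have [y [/=]] := filter_ex (filterI (Fx n.+1) (Fx n)).
  rewrite !ball_qnrm => xy1 xy.
  have -> : x n.+1 - x n = (x n.+1 - y) + - (x n - y) by rewrite opprB addrA subrK.
  have qN (z : Q) : qnrm (- z) = qnrm z.
    by have := normrN z; rewrite !qnormE => /complexI.
  rewrite (le_lt_trans (qnrmD _ _))// qN mulrDl mul1r ltrD//.
  by rewrite (lt_trans xy1)// -(eS n) ltrDl.
have /(_ _)/cid-/all_sig[a /all_and2[xa a_le]] n :
    exists a : A, qpi J a = x n.+1 - x n /\ nrm a < 2 * e n.
  by have [a ax alt] := qnrm_lt (x_step n); exists a.
pose b n := repr (x 0%N) + \sum_(k < n) a k.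
have bx n : qpi J (b n) = x n.
  elim: n => [|n IH]; first by rewrite /b big_ord0 addr0 qpi_repr.
  by rewrite /b big_ord_recr /= addrA qpiD IH xa addrC subrK.
have b_le n k : nrm (b n - b (n + k)%N) <= 4 * (e n - e (n + k)%N).
  elim: k => [|k IH]; first by rewrite addn0 !subrr nrm0 mulr0.
  have -> : b n - b (n + k.+1)%N = (b n - b (n + k)%N) - a (n + k)%N.
    by rewrite /b addnS big_ord_recr /= addrA opprD addrA.
  rewrite (le_trans (nrmB _ _))// (le_trans (lerD IH (ltW (a_le _))))//.
  by rewrite addnS -(eS (n + k)); lra.
have b_lt n m : (n <= m)%N -> nrm (b n - b m) < 4 * e n.
  move=> /subnKC <-; rewrite (le_lt_trans (b_le _ _))// ltr_pM2l//.
  by rewrite ltrBlDr ltrDl.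
have b_cvg : cvgn b.
  apply: cauchy_cvg; apply: cauchy_exP => _ /realE[r r0 ->].
  have [n Hn] := e_small (divr_gt0 r0 (ltr0Sn R 3)).
  exists (b n); exists n => // m /= nm; rewrite ball_nrm.
  by rewrite (lt_trans (b_lt _ _ nm))// mulrC -ltr_pdivlMr// Hn.
apply/cvg_ex; exists (qpi J (limn b)).
apply/fcvg_ballP => _ /realE[r r0 ->].
have r2 : 0 < r / 2 by rewrite divr_gt0.
have [n1 Hn1] := e_small r2.
have [n2 _ Hn2] : \forall n \near \oo, ball (limn b) (r / 2)%:C (b n).
  by apply: (cvg_ball b_cvg); rewrite ltcR.
pose n := maxn n1 n2.
apply: filterS (Fx n) => y; rewrite !ball_qnrm => xy.
have -> : qpi J (limn b) - y = (qpi J (limn b) - x n) + (x n - y).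
  by rewrite addrA subrK.
rewrite (le_lt_trans (qnrmD _ _))// [ltRHS]splitr ltrD//.
  rewrite -bx -qpiB (le_lt_trans (qnrm_le _ _))// -ball_nrm.
  exact/Hn2/leq_maxr.
by rewrite (lt_trans xy)// Hn1// leq_maxl.
Qed.

HB.instance Definition _ := Uniform_isComplete.Build Q cstar_quot_complete.

End QuotientComplete.

HB.instance Definition _ (R : realType) (A : cstarAlgType R)
    (J : closedIdeal A) :=
  StarAlgebra_isCStarAlgebra.Build R (cstar_quot J)
    (@quot_normcM R A J) (@quot_cstar_identity R A J).

(* The map b + J1 |-> b + J2; it is well defined only if J1 is included in J2,
   see quot_mapE. *)
Definition quot_map (R : realType) (A : cstarAlgType R)
    (J1 J2 : closedIdeal A) (x : cstar_quot J1) : cstar_quot J2 :=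
  qpi J2 (repr x).

Lemma quot_mapE (R : realType) (A : cstarAlgType R) (J1 J2 : closedIdeal A)
    (b : A) : {subset J1 <= J2} -> quot_map J2 (qpi J1 b) = qpi J2 b.
Proof. by move=> J12; apply/qpi_eq/J12; exact: repr_qpi. Qed.

Definition approx_lifting (R : realType) (A B : cstarAlgType R) :=
  forall (J : nat -> closedIdeal B) (Joo : closedIdeal B),
    (forall n, {subset J n <= J n.+1}) ->
    [set` Joo] = closure (\bigcup_n [set` J n]) ->
  forall phi : A -> cstar_quot Joo, star_hom phi ->
  exists psi : forall n, A -> cstar_quot (J n),
    (forall n, star_hom (psi n)) /\
    (forall a : A, (fun n => quot_map Joo (psi n a)) @ \oo --> phi a).

Definition WSP (R : realType) (A : cstarAlgType R) :=
  forall B : cstarAlgType R, separable_space B -> approx_lifting A B.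

Definition WSP1 (R : realType) (A : cstarAlgType R) :=
  forall B : cstarAlgType R, separable_space B -> unital B ->
  approx_lifting A B.

(* Main.v *)
Require Import Defs.
From HB Require Import structures.
From mathcomp Require Import all_boot all_order all_algebra.
From mathcomp Require Import complex.
From mathcomp Require Import all_classical all_reals all_analysis.
From mathcomp Require Import ring lra.
Import Defs.

(** The implication from WSP to WSP1 is a restriction to unital [B]. For the
    converse, a lifting problem in a separable [B] is moved to the unitization
    [U] of [B], in which [B] and its closed ideals are closed ideals again; [U]
    is unital and separable. An ideal [J] of [B] gives an inclusion of [B / J]
    in [U / J] whose image is the kernel of the character [quot_scal] of
    [U / J], so [phi : A -> B / J] may be regarded as a map into [U / J], and
    WSP1 supplies star homomorphisms [psi n : A -> U / J n] that approximate it.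

    It remains to see that [psi n] takes values in [B / J n]. This is where the
    unit [e] of [A] is used. The scalars [quot_scal (psi n e)] are idempotent,
    hence equal to 0 or 1, and they converge to [quot_scal (phi e) = 0], so they
    vanish for large [n] ([quot_scal_idem]). Then
    [quot_scal (psi n a) = quot_scal (psi n e) * quot_scal (psi n a) = 0] for
    every [a] ([quot_scal_unit]), and the coordinate map [quot_vec] brings
    [psi n] back to [B / J n]; it is multiplicative on the kernel of
    [quot_scal] ([quot_vecM]). The finitely many remaining maps are replaced by
    zero.

    The rest is the construction of [U]. On pairs [(b, l)] it uses the larger of
    [|l|] and the norm of [z |-> b z + l z] as an operator on [B]. The first
    term makes this a norm even when [B] has a unit of its own, so unital and
    non-unital [B] are treated alike; the second satisfies the C*-identity by
    the usual computation with left multiplications. The norm is equivalent to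
    the sum of the coordinate norms, which yields completeness, separability,
    and the continuity of all the maps between [B] and [U]. *)

Set Implicit Arguments.
Unset Strict Implicit.
Unset Printing Implicit Defensive.

Import Order.TTheory GRing.Theory Num.Theory.
Import numFieldNormedType.Exports.

Local Open Scope classical_set_scope.
Local Open Scope ring_scope.
Local Open Scope complex_scope.
Local Open Scope quotient_scope.

(** * The unitization as a star algebra *)

Definition unitization (R : realType) (B : cstarAlgType R) : Type :=
  (B * R[i]^o)%type.

Section UnitizationAlgebra.
Variables (R : realType) (B : cstarAlgType R).
Local Notation U := (unitization B).
Implicit Types (x y z : U) (b : B) (c : R[i]).

HB.instance Definition _ := GRing.Lmodule.copy U (B * R[i]^o)%type.

Definition umul x y : U :=
  (x.1 *c y.1 + x.2 *: y.1 + y.2 *: x.1, x.2 * y.2).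

Definition uadj x : U := (adj x.1, Num.conj x.2).

Let umulA : associative umul.
Proof.
move=> [a l] [b m] [d n]; rewrite /umul /=; congr pair; last exact: mulrA.
rewrite !(cmulDl, cmulDr, cmulZl, cmulZr, scalerDr, scalerA) cmulA.
rewrite [n * l]mulrC [n * m]mulrC.
by rewrite !addrA (ACl (1*4*2*5*3*6*7)).
Qed.

Let umulDl : left_distributive umul +%R.
Proof.
move=> [a l] [b m] [d n]; rewrite /umul /=; congr pair; last exact: mulrDl.
rewrite cmulDl scalerDl scalerDr; exact: (AC (2*2*2) ((1*3*5)*(2*4*6))).
Qed.

Let umulDr : right_distributive umul +%R.
Proof.
move=> [a l] [b m] [d n]; rewrite /umul /=; congr pair; last exact: mulrDr.
rewrite cmulDr scalerDl scalerDr; exact: (AC (2*2*2) ((1*3*5)*(2*4*6))).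
Qed.

Let umulZl c x y : umul (c *: x) y = c *: umul x y.
Proof.
case: x y => [a l] [b m]; rewrite /umul /=; congr pair.
  by rewrite cmulZl !scalerDr !scalerA [m * c]mulrC.
exact: (esym (mulrA c l m)).
Qed.

Let umulZr c x y : umul x (c *: y) = c *: umul x y.
Proof.
case: x y => [a l] [b m]; rewrite /umul /=; congr pair.
  by rewrite cmulZr !scalerDr !scalerA [l * c]mulrC.
exact: mulrCA.
Qed.

Let uadjK : involutive uadj.
Proof. by case=> a l; rewrite /uadj /= adjK conjCK. Qed.

Let uadjD : {morph uadj : x y / x + y}.
Proof. by case=> a l [b m]; rewrite /uadj /= adjD rmorphD. Qed.

Let uadjZ c x : uadj (c *: x) = Num.conj c *: uadj x.
Proof.
case: x => a l; congr pair; [exact: adjZ|exact: rmorphM].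
Qed.

Let uadjM x y : uadj (umul x y) = umul (uadj y) (uadj x).
Proof.
case: x y => [a l] [b m]; rewrite /uadj /umul /=.
congr pair; last by rewrite rmorphM mulrC.
by rewrite !adjD adjM !adjZ addrAC.
Qed.

HB.instance Definition _ := Lmodule_isStarAlgebra.Build R U
  umulA umulDl umulDr umulZl umulZr uadjK uadjD uadjZ uadjM.

Lemma cmulUE x y : x *c y = (x.1 *c y.1 + x.2 *: y.1 + y.2 *: x.1, x.2 * y.2).
Proof. by []. Qed.

Lemma adjUE x : adj x = (adj x.1, Num.conj x.2) :> U.
Proof. by []. Qed.

Lemma unital_unitization : unital U.
Proof.
exists (0, 1); split=> -[b l]; rewrite cmulUE /=; congr pair;
  by rewrite ?mul1r ?mulr1// ?cmul0l ?cmul0r scale1r scaler0 ?add0r ?addr0.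
Qed.

(** * The norm of the unitization *)

Definition uact x b : B := x.1 *c b + x.2 *: b.

Lemma uactM x y b : uact (x *c y) b = uact x (uact y b).
Proof.
case: x y => [a l] [d m]; rewrite /uact /=.
rewrite !(cmulDl, cmulDr, cmulZl, cmulZr, scalerDr, scalerA) cmulA !addrA.
by rewrite (ACl (1*3*2*4)).
Qed.

Lemma uactD x y b : uact (x + y) b = uact x b + uact y b.
Proof. by rewrite /uact /= cmulDl scalerDl addrACA. Qed.

Lemma uactZ c x b : uact (c *: x) b = c *: uact x b.
Proof. by rewrite /uact /= cmulZl scalerDr scalerA. Qed.

(** The action is a star representation on the Hilbert module [B], with
    inner product [adj a *c b]. *)
Lemma uact_adj x a b : adj (uact x a) *c b = adj a *c uact (adj x) b.
Proof. by rewrite /uact adjD adjM adjZ cmulDl cmulDr cmulA cmulZl cmulZr. Qed.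

(** The least element of this set is the larger of [|x.2|] and the operator norm
    of [uact x]; one infimum over common bounds serves for both. *)
Let unrm_set x : set R := [set r | `|x.2| <= r%:C /\
  forall b, nrm (uact x b) <= r * nrm b].

Definition unrm x : R := inf (unrm_set x).

Let normCE c : `|c| = (complex.Re `|c|)%:C.
Proof. by rewrite RRe_real ?normr_real. Qed.

Let unrm_set_ge0 x r : unrm_set x r -> 0 <= r.
Proof. by move=> [xr _]; rewrite -ler0c (le_trans _ xr). Qed.

Let unrm_set_ex x : unrm_set x (nrm x.1 + complex.Re `|x.2|).
Proof.
split; first by rewrite rmorphD /= -normCE lerDr ler0c nrm_ge0.
move=> b; rewrite (le_trans (nrmD _ _))// mulrDl nrmZ lerD//.
exact: nrmM.
Qed.

Let unrm_has_inf x : has_inf (unrm_set x).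
Proof.
by split; [exists (nrm x.1 + complex.Re `|x.2|)|exists 0 => r /unrm_set_ge0].
Qed.

Lemma unrm_le x (r : R) : `|x.2| <= r%:C ->
  (forall b, nrm (uact x b) <= r * nrm b) -> unrm x <= r.
Proof. by move=> xr xb; apply: ge_inf; [case: (unrm_has_inf x)|]. Qed.

Lemma unrm_le_sum x : unrm x <= nrm x.1 + complex.Re `|x.2|.
Proof. by have [? ?] := unrm_set_ex x; exact: unrm_le. Qed.

Lemma nrm_uact x b : nrm (uact x b) <= unrm x * nrm b.
Proof.
have [b0|b0] := eqVneq (nrm b) 0.
  have [_ /(_ b)] := unrm_set_ex x; by rewrite b0 !mulr0.
have {}b0 : 0 < nrm b by rewrite lt_neqAle eq_sym b0 nrm_ge0.
rewrite -ler_pdivrMr//; apply: lb_le_inf; first by case: (unrm_has_inf x).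
by move=> r [_ xr]; rewrite ler_pdivrMr.
Qed.

Lemma unrm_scal x : `|x.2| <= (unrm x)%:C.
Proof.
rewrite normCE lecR; apply: lb_le_inf; first by case: (unrm_has_inf x).
by move=> r [xr _]; rewrite -lecR -normCE.
Qed.

Lemma unrm_ge0 x : 0 <= unrm x.
Proof. by rewrite -ler0c (le_trans _ (unrm_scal x)). Qed.

(** By the C*-identity, left multiplication by [x.1] attains the norm of [x.1]
    at [adj x.1]; it differs from the action of [x] by the scalar [x.2]. Each of
    the two contributes at most [unrm x], whence the factor 2. *)
Lemma nrm_fst x : nrm x.1 <= 2 * unrm x.
Proof.
have [x0|x0] := eqVneq (nrm x.1) 0; first by rewrite x0 mulr_ge0 ?unrm_ge0.
have {}x0 : 0 < nrm x.1 by rewrite lt_neqAle eq_sym x0 nrm_ge0.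
rewrite -(ler_pM2r x0) -expr2 -nrm_cstar'.
have -> : x.1 *c adj x.1 = uact x (adj x.1) - x.2 *: adj x.1 by rewrite addrK.
rewrite (le_trans (nrmB _ _))// nrmZ nrm_adj mulr_natl mulr2n mulrDl lerD//.
  by rewrite -[X in _ * X]nrm_adj nrm_uact.
by rewrite ler_pM2r// -lecR -normCE unrm_scal.
Qed.

Lemma unrmD x y : unrm (x + y) <= unrm x + unrm y.
Proof.
apply: unrm_le => [|b].
  by rewrite rmorphD /= (le_trans (ler_normD _ _))// lerD// unrm_scal.
by rewrite uactD mulrDl (le_trans (nrmD _ _))// lerD// nrm_uact.
Qed.

Let unrmZ_le c x : unrm (c *: x) <= complex.Re `|c| * unrm x.
Proof.
apply: unrm_le => [|b].
  by rewrite rmorphM /= -normCE normrM ler_wpM2l// unrm_scal.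
rewrite uactZ nrmZ -mulrA ler_wpM2l ?nrm_uact// -ler0c -normCE normr_ge0//.
Qed.

Lemma unrmZ c x : (unrm (c *: x))%:C = `|c| * (unrm x)%:C.
Proof.
rewrite [in RHS]normCE -rmorphM; congr _%:C; apply/eqP.
rewrite eq_le unrmZ_le andTb.
have [->|c0] := eqVneq c 0; first by rewrite normr0 mul0r unrm_ge0.
have n0 : 0 < complex.Re `|c| by rewrite -ltcR -normCE normr_gt0.
rewrite -ler_pdivlMl// -{1}[x](scalerK c0) (le_trans (unrmZ_le _ _))//.
rewrite ler_wpM2r ?unrm_ge0// normfV -lecR fmorphV.
by rewrite !RRe_real ?realV ?normr_real.
Qed.

Lemma unrm_eq0 x : unrm x = 0 -> x = 0.
Proof.
move=> x0; case: x x0 => b l x0; congr pair.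
  apply: nrm_eq0; apply/eqP; rewrite eq_le nrm_ge0 andbT.
  by have := nrm_fst (b, l); rewrite x0 mulr0.
by apply/eqP; rewrite -normr_le0; have := unrm_scal (b, l); rewrite x0.
Qed.

Let unormD x y : (unrm (x + y))%:C <= (unrm x)%:C + (unrm y)%:C.
Proof. by rewrite -rmorphD lecR unrmD. Qed.

Let unorm_eq0 x : (unrm x)%:C = 0 -> x = 0.
Proof. by move=> /(@complexI R _ 0) /unrm_eq0. Qed.

HB.instance Definition _ := @Lmodule_isNormed.Build R[i] U
  (fun x => (unrm x)%:C) unormD unrmZ unorm_eq0.

Lemma unormE x : `|x| = (unrm x)%:C.
Proof. by []. Qed.

Lemma unrmM x y : unrm (x *c y) <= unrm x * unrm y.
Proof.
apply: unrm_le => [|b].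
  by rewrite normrM rmorphM /= ler_pM// unrm_scal.
rewrite uactM (le_trans (nrm_uact _ _))// -mulrA ler_wpM2l ?unrm_ge0//.
exact: nrm_uact.
Qed.

(** On vectors, [|x b|^2 = |b^* (x^* x b)|] by the C*-identity in [B], and this
    is at most [|b| |x^* x| |b|]. *)
Lemma unrm_cstar_ge x : unrm x ^+ 2 <= unrm (adj x *c x).
Proof.
have [s s0 s2] : exists2 s, 0 <= s & s ^+ 2 = unrm (adj x *c x).
  exists (Num.sqrt (unrm (adj x *c x))); first exact: sqrtr_ge0.
  by rewrite sqr_sqrtr ?unrm_ge0.
rewrite -s2 ler_sqr ?nnegrE ?unrm_ge0//.
apply: unrm_le => [|b].
  rewrite -ler_sqr ?nnegrE ?normr_ge0 ?ler0c//.
  have -> : s%:C ^+ 2 = (unrm (adj x *c x))%:C by rewrite -s2 rmorphXn.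
  by rewrite (le_trans _ (unrm_scal _))// normrM norm_conjC expr2.
rewrite -ler_sqr ?nnegrE ?nrm_ge0 ?mulr_ge0 ?nrm_ge0//.
rewrite exprMn s2 -nrm_cstar uact_adj -uactM.
rewrite (le_trans (nrmM _ _))// nrm_adj expr2 mulrCA ler_wpM2l ?nrm_ge0//.
exact: nrm_uact.
Qed.

Lemma unrm_adj x : unrm (adj x) = unrm x.
Proof.
suff le_adj y : unrm y <= unrm (adj y).
  by apply/eqP; rewrite eq_le le_adj -{2}[x]adjK le_adj.
have [y0|] := eqVneq (unrm y) 0; first by rewrite y0 unrm_ge0.
rewrite neq_lt ltNge unrm_ge0 /= => y_gt0.
by rewrite -(ler_pM2r y_gt0) -expr2 (le_trans (unrm_cstar_ge _)) ?unrmM.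
Qed.

Lemma unitization_normcM x y : `|x *c y| <= `|x| * `|y|.
Proof. by rewrite !unormE -rmorphM lecR unrmM. Qed.

Lemma unitization_cstar_identity x : `|adj x *c x| = `|x| ^+ 2.
Proof.
rewrite !unormE -rmorphXn; congr _%:C; apply/eqP; rewrite eq_le unrm_cstar_ge.
by rewrite andbT (le_trans (unrmM _ _))// unrm_adj expr2.
Qed.

End UnitizationAlgebra.

(** * Lipschitz maps between complex normed spaces *)

Section ComplexRadii.
Variable R : realType.

Lemma complex_pos (r : R[i]) : 0 < r -> exists2 s : R, 0 < s & r = s%:C.
Proof.
move=> r0; have rE : r = (complex.Re r)%:C by rewrite RRe_real// gtr0_real.
by exists (complex.Re r) => //; rewrite -ltcR -rE.
Qed.

Lemma normc_ge_Im (c : R[i]) : `|complex.Im c|%:C <= `|c|.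
Proof. by rewrite normc_def lecR -sqrtr_sqr ler_wsqrtr// lerDr sqr_ge0. Qed.

Lemma normc_le_ReIm (c : R[i]) :
  `|c| <= (`|complex.Re c| + `|complex.Im c|)%:C.
Proof.
rewrite normc_def lecR -ler_sqr ?nnegrE ?sqrtr_ge0 ?addr_ge0//.
rewrite sqr_sqrtr ?addr_ge0 ?sqr_ge0// sqrrD.
rewrite !real_normK ?num_real// [leRHS]addrAC lerDl.
by rewrite mulrn_wge0// mulr_ge0.
Qed.

Lemma lipschitz_continuous (V W : normedModType R[i]) (f : V -> W) (k : R) :
  0 < k -> (forall x y, `|f x - f y| <= k%:C * `|x - y|) -> continuous f.
Proof.
move=> k0 fk x; apply/cvgrPdist_lt => e e0.
have kC : 0 < k%:C :> R[i] by rewrite ltcR.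
near=> y; rewrite (le_lt_trans (fk _ _))// mulrC -ltr_pdivlMr//.
near: y; apply: (@cvgr_dist_lt _ _ _ (nbhs x) _ id x) => //.
exact: divr_gt0.
Unshelve. all: by end_near. Qed.

Lemma cauchy_lipschitz (V W : normedModType R[i]) (f : V -> W) (k : R)
    (F : set_system V) :
  0 < k -> (forall x y, `|f x - f y| <= k%:C * `|x - y|) ->
  ProperFilter F -> cauchy F -> cauchy (f @ F).
Proof.
move=> k0 fk FF /cauchyP Fc; apply/cauchyP => e e0.
have kC : 0 < k%:C :> R[i] by rewrite ltcR.
have [x Fx] := Fc _ (divr_gt0 e0 kC); exists (f x).
apply: (filterS (F := F) _ Fx) => y; rewrite -!ball_normE /= => xy.
by rewrite (le_lt_trans (fk _ _))// mulrC -ltr_pdivlMr.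
Qed.

(** Stated for real-valued maps so that the real and imaginary parts of a
    Cauchy filter of complex numbers can use the completeness of [R]. *)
Lemma cauchy_real_lipschitz (V : normedModType R[i]) (f : V -> R)
    (F : set_system V) :
  (forall x y, `|f x - f y|%:C <= `|x - y|) ->
  ProperFilter F -> cauchy F -> cauchy (f @ F).
Proof.
move=> fk FF /cauchyP Fc; apply/cauchyP => e e0.
have [|x Fx] := Fc e%:C; first by rewrite ltcR.
exists (f x); apply: (filterS (F := F) _ Fx) => y; rewrite -!ball_normE /= => xy.
by rewrite -ltcR (le_lt_trans (fk _ _)).
Qed.

End ComplexRadii.

(** * Completeness and separability of the unitization *)

Section UnitizationTopology.
Variables (R : realType) (B : cstarAlgType R).
Local Notation U := (unitization B).
Implicit Types (x y : U).

Lemma unrm_le_ReIm x :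
  unrm x <= nrm x.1 + (`|complex.Re x.2| + `|complex.Im x.2|).
Proof.
rewrite (le_trans (unrm_le_sum _))// lerD2l -lecR.
by rewrite RRe_real ?normr_real ?normc_le_ReIm.
Qed.

Lemma fst_lipschitz x y : `|x.1 - y.1| <= 2%:C * `|x - y|.
Proof. by rewrite unormE nrmE -rmorphM lecR; exact: nrm_fst (x - y). Qed.

Lemma snd_lipschitz x y : `|x.2 - y.2| <= `|x - y|.
Proof. by rewrite unormE; exact: unrm_scal (x - y). Qed.

Lemma unitization_complete (F : set_system U) :
  ProperFilter F -> cauchy F -> cvg F.
Proof.
move=> FF Fc.
have /cauchy_cvg/cvg_ex[/= b Fb] : cauchy (fst @ F : set_system B).
  exact: cauchy_lipschitz (ltr0Sn R 1) fst_lipschitz _ Fc.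
have /cauchy_cvg/cvg_ex[/= p Fp] :
    cauchy ((fun x : U => complex.Re x.2) @ F : set_system R).
  apply: cauchy_real_lipschitz Fc => x y.
  by rewrite -raddfB (le_trans (normc_ge_Re _))// snd_lipschitz.
have /cauchy_cvg/cvg_ex[/= q Fq] :
    cauchy ((fun x : U => complex.Im x.2) @ F : set_system R).
  apply: cauchy_real_lipschitz Fc => x y.
  by rewrite -raddfB (le_trans (normc_ge_Im _))// snd_lipschitz.
apply/cvg_ex; exists ((b, p +i* q) : U).
apply/fcvg_ballP => _ /complex_pos[r r0 ->].
have r3 : 0 < r / 3 by rewrite divr_gt0.
near=> x; rewrite -ball_normE /= unormE ltcR.
rewrite (le_lt_trans (unrm_le_ReIm _))//=.
have -> : r = r / 3 + (r / 3 + r / 3) by lra.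
rewrite !ltrD//.
- rewrite -ltcR -nrmE; near: x.
  by apply: (cvgr_dist_lt _ _ Fb); rewrite ltcR.
- rewrite raddfB; near: x; exact: (cvgr_dist_lt _ _ Fp).
- rewrite raddfB; near: x; exact: (cvgr_dist_lt _ _ Fq).
Unshelve. all: by end_near. Qed.

HB.instance Definition _ := Uniform_isComplete.Build U unitization_complete.

HB.instance Definition _ := StarAlgebra_isCStarAlgebra.Build R U
  (@unitization_normcM R B) (@unitization_cstar_identity R B).

Lemma fst_continuous : continuous (fst : U -> B).
Proof. exact: lipschitz_continuous (ltr0Sn R 1) fst_lipschitz. Qed.

Lemma snd_continuous : continuous (snd : U -> R[i]^o).
Proof.
apply: (@lipschitz_continuous _ _ _ _ 1) => // x y.
by rewrite mul1r snd_lipschitz.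
Qed.

Lemma inl_continuous : continuous (fun b : B => (b, 0) : U).
Proof.
apply: (@lipschitz_continuous _ _ _ _ 1) => // x y.
have -> : (x, 0) - (y, 0) = (x - y, 0) :> U by congr pair; rewrite subrr.
rewrite mul1r unormE nrmE lecR (le_trans (unrm_le_sum _))//.
by rewrite normr0 addr0.
Qed.

Lemma separable_unitization : separable_space B -> separable_space U.
Proof.
move=> [D cD dD].
pose Q := range (@ratr R).
pose g (t : B * (R * R)) : U := (t.1, t.2.1 +i* t.2.2).
exists (g @` (D `*` (Q `*` Q))).
  apply: card_le_trans (card_image_le _ _) _.
  have cQ : countable Q.
    by apply: card_le_trans (card_image_le _ _) _; exact: countableP.
  by do 2?[apply: countableX].
move=> O [x Ox] oO.
have [e e0 xO] : exists2 e : R, 0 < e & forall y, unrm (x - y) < e -> O y.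
  have /nbhs_ballP[_ /= /complex_pos[e e0 ->] xO] := open_nbhs_nbhs (conj oO Ox).
  by exists e => // y xy; apply: xO; rewrite -ball_normE /= unormE ltcR.
have e3 : 0 < e / 3 by rewrite divr_gt0.
have [||b [xb Db]] := dD (ball x.1 (e / 3)%:C).
- by exists x.1; apply: ballxx; rewrite ltcR.
- by apply: ball_open; rewrite ltcR.
have [||p [xp Qp]] := @dense_rat R (ball (complex.Re x.2) (e / 3)).
- by exists (complex.Re x.2); exact: ballxx.
- exact: ball_open.
have [||q [xq Qq]] := @dense_rat R (ball (complex.Im x.2) (e / 3)).
- by exists (complex.Im x.2); exact: ballxx.
- exact: ball_open.
exists (g (b, (p, q))); split; last by exists (b, (p, q)).
apply: xO; rewrite (le_lt_trans (unrm_le_ReIm _))//.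
have -> : e = e / 3 + (e / 3 + e / 3) by lra.
move: xb xp xq; rewrite -!ball_normE /= nrmE ltcR => xb xp xq.
by rewrite !ltrD// raddfB.
Qed.

End UnitizationTopology.

(** * Ideals and quotients of the unitization *)

Lemma qpi_linear (R : realType) (A : cstarAlgType R) (I : closedIdeal A) :
  linear (qpi I).
Proof. by have [] := qpi_star_hom I. Qed.

Section UnitizationIdeals.
Variables (R : realType) (B : cstarAlgType R).
Local Notation U := (unitization B).
Implicit Types (J : closedIdeal B) (x y : U) (b : B).

Definition uideal J : {pred U} := fun x => (x.2 == 0) && (x.1 \in J).

Lemma uidealP J x : reflect (x.2 = 0 /\ x.1 \in J) (x \in uideal J).
Proof. by apply: (iffP andP) => -[/eqP ? ?]. Qed.

Let uideal_zmod J : zmod_closed (uideal J).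
Proof.
split; first by apply/uidealP; rewrite rpred0.
move=> x y /uidealP[x2 x1] /uidealP[y2 y1]; apply/uidealP => /=.
by rewrite x2 y2 subrr rpredB.
Qed.

HB.instance Definition _ J := GRing.isZmodClosed.Build U (uideal J)
  (uideal_zmod J).

Let uidealZ J (c : R[i]) x : x \in uideal J -> c *: x \in uideal J.
Proof.
move=> /uidealP[x2 x1]; apply/uidealP => /=.
by rewrite x2 scaler0 idealZ.
Qed.

Let uidealMl J x y : y \in uideal J -> x *c y \in uideal J.
Proof.
move=> /uidealP[y2 y1]; apply/uidealP; rewrite cmulUE /= y2 mulr0.
by rewrite scale0r addr0 rpredD ?idealMl ?idealZ.
Qed.

Let uidealMr J x y : x \in uideal J -> x *c y \in uideal J.
Proof.
move=> /uidealP[x2 x1]; apply/uidealP; rewrite cmulUE /= x2 mul0r.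
by rewrite scale0r addr0 rpredD ?idealMr ?idealZ.
Qed.

Let uideal_closed J : closed [set` uideal J].
Proof.
have -> : [set` uideal J] =
    (snd : U -> R[i]^o) @^-1` [set 0] `&` (fst : U -> B) @^-1` [set` J].
  by apply/seteqP; split=> x /= /uidealP.
apply: closedI; apply: closed_comp; do ?[by move=> x _; exact: snd_continuous
  |by move=> x _; exact: fst_continuous].
- exact: (accessible_closed_set1 (hausdorff_accessible (@norm_hausdorff _ _))).
- exact: ideal_closed.
Qed.

HB.instance Definition _ J := isClosedIdeal.Build R U (uideal J)
  (@uidealZ J) (@uidealMl J) (@uidealMr J) (@uideal_closed J).

Definition unitization_ideal J : closedIdeal U := uideal J.
Local Notation "J ^u" := (unitization_ideal J) (at level 2, format "J ^u").

Lemma unitization_idealP J x : reflect (x.2 = 0 /\ x.1 \in J) (x \in J^u).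
Proof. exact: uidealP. Qed.

Lemma unitization_idealS J1 J2 : {subset J1 <= J2} -> {subset J1^u <= J2^u}.
Proof.
move=> J12 x /unitization_idealP[x2 x1]; apply/unitization_idealP.
by split=> //; exact: J12.
Qed.

(** The right-hand closure is taken in the unitization. It contains the ideal on
    the left because [b |-> (b, 0)] is continuous, and is contained in it because
    that ideal is closed. *)
Lemma unitization_ideal_closure (J : nat -> closedIdeal B) (Joo : closedIdeal B) :
  [set` Joo] = closure (\bigcup_n [set` J n]) ->
  [set` Joo^u] = closure (\bigcup_n [set` (J n)^u]).
Proof.
move=> JE; apply/seteqP; split=> [[b l] /unitization_idealP[/= -> Jb]|].
  rewrite closureEbigcap => C [clC JC].
  have : closure (\bigcup_n [set` J n]) b by rewrite -JE.
  rewrite closureEbigcap => /(_ ((fun b => (b, 0) : U) @^-1` C)); apply; split.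
    by apply: closed_comp clC => x _; exact: inl_continuous.
  move=> d [n _ Jd]; apply: JC; exists n => //.
  by apply/unitization_idealP.
have /closure_id -> : closed [set` Joo^u] by exact: ideal_closed.
apply: closureS => x [n _ /unitization_idealP[x2 x1]].
apply/unitization_idealP; split=> //.
have : [set` Joo] x.1 by rewrite JE; apply: subset_closure; exists n.
by [].
Qed.

Section Quotient.
Variable J : closedIdeal B.
Local Notation Q := (cstar_quot J^u).
Implicit Types u v : Q.

(** The character of the unitization with kernel [B], on a quotient by an ideal
    of [B]. *)
Definition quot_scal u : R[i] := (repr u).2.

(** A linear retraction of [quot_inl] below; it is multiplicative only on the
    kernel of [quot_scal], see [quot_vecM]. *)
Definition quot_vec u : cstar_quot J := qpi J (repr u).1.

Lemma quot_scalE x : quot_scal (qpi J^u x) = x.2.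
Proof.
have /unitization_idealP[/= x2 _] := repr_qpi J^u x.
by apply/eqP; rewrite -subr_eq0; apply/eqP.
Qed.

Lemma quot_vecE x : quot_vec (qpi J^u x) = qpi J x.1.
Proof. by have /unitization_idealP[/= _ x1] := repr_qpi J^u x; apply/qpi_eq. Qed.

Lemma quot_scalB : {morph quot_scal : u v / u - v}.
Proof.
elim/qpiW => x; elim/qpiW => y; rewrite -qpiB !quot_scalE; exact: raddfB.
Qed.

Lemma quot_scalM : {morph quot_scal : u v / u *c v >-> u * v}.
Proof. by elim/qpiW => x; elim/qpiW => y; rewrite cmul_qpi !quot_scalE. Qed.

Lemma quot_vec_linear : linear quot_vec.
Proof.
move=> c; elim/qpiW => x; elim/qpiW => y.
by rewrite -qpi_linear !quot_vecE -qpi_linear.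
Qed.

Lemma quot_vec_adj : {morph quot_vec : u / adj u}.
Proof. by elim/qpiW => x; rewrite adj_qpi !quot_vecE adj_qpi. Qed.

Lemma quot_vecM u v : quot_scal u = 0 -> quot_scal v = 0 ->
  quot_vec (u *c v) = quot_vec u *c quot_vec v.
Proof.
elim/qpiW: u => x; elim/qpiW: v => y; rewrite cmul_qpi !quot_scalE => x2 y2.
by rewrite !quot_vecE cmul_qpi cmulUE /= x2 y2 !scale0r !addr0.
Qed.

Lemma quot_scal_le u : `|quot_scal u| <= `|u|.
Proof.
rewrite qnormE; have -> : `|quot_scal u| = (complex.Re `|quot_scal u|)%:C.
  by rewrite RRe_real ?normr_real.
rewrite lecR; apply/ler_addgt0Pr => e /(qnrm_near u)[x <- xe].
rewrite quot_scalE (le_trans _ xe)// -lecR RRe_real ?normr_real//.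
exact: unrm_scal.
Qed.

Lemma quot_vec_le u : `|quot_vec u| <= 2%:C * `|u|.
Proof.
rewrite !qnormE -rmorphM lecR; apply: qnrmP => e e0.
have [x xu xe] := qnrm_near u (divr_gt0 e0 (ltr0Sn R 1)).
exists x.1; first by rewrite -quot_vecE xu.
rewrite (le_trans (nrm_fst _))// (le_trans (_ : _ <= 2 * (qnrm u + e / 2)))//.
  by rewrite ler_pM2l.
by rewrite mulrDr mulrCA mulfV ?mulr1.
Qed.

Lemma quot_scal_continuous : continuous (quot_scal : Q -> R[i]^o).
Proof.
apply: (@lipschitz_continuous _ _ _ _ 1) => // u v.
by rewrite mul1r -quot_scalB quot_scal_le.
Qed.

Lemma quot_vec_continuous : continuous quot_vec.
Proof.
apply: (@lipschitz_continuous _ _ _ _ 2) => // u v.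
have -> : quot_vec u - quot_vec v = quot_vec (u - v).
  by rewrite addrC -scaleN1r -quot_vec_linear scaleN1r addrC.
exact: quot_vec_le.
Qed.

Definition quot_inl (q : cstar_quot J) : Q := qpi J^u (repr q, 0).

Lemma quot_inlE b : quot_inl (qpi J b) = qpi J^u (b, 0).
Proof.
apply/qpi_eq/unitization_idealP; split; first by rewrite /= subrr.
exact: repr_qpi.
Qed.

Lemma quot_inl_star_hom : star_hom quot_inl.
Proof.
split=> [c|| ]; do ?elim/qpiW => a; try elim/qpiW => b.
- rewrite -qpi_linear !quot_inlE -qpi_linear; congr qpi; congr pair.
  by rewrite /= scaler0 addr0.
- rewrite cmul_qpi !quot_inlE cmul_qpi cmulUE /=.
  by rewrite mulr0 !scale0r !addr0.
- by rewrite adj_qpi !quot_inlE adj_qpi adjUE /= rmorph0.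
Qed.

Lemma quot_inlK : cancel quot_inl quot_vec.
Proof. by elim/qpiW => b; rewrite quot_inlE quot_vecE. Qed.

Lemma quot_scal_inl q : quot_scal (quot_inl q) = 0.
Proof. by elim/qpiW: q => b; rewrite quot_inlE quot_scalE. Qed.

Lemma quot_vec_star_hom (A : cstarAlgType R) (psi : A -> Q) :
  star_hom psi -> (forall a, quot_scal (psi a) = 0) ->
  star_hom (quot_vec \o psi).
Proof.
move=> [psiL psiM psiA] psi0; split=> [c a b|a b|a] /=.
- by rewrite psiL quot_vec_linear.
- by rewrite psiM quot_vecM.
- by rewrite psiA quot_vec_adj.
Qed.

(** A homomorphism that maps the unit into the ideal [B] of the unitization maps
    everything there. *)
Lemma quot_scal_unit (A : cstarAlgType R) (e : A) (psi : A -> Q) :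
  left_id e (@cmul R A) -> star_hom psi -> quot_scal (psi e) = 0 ->
  forall a, quot_scal (psi a) = 0.
Proof.
by move=> e1 [_ psiM _] pe a; rewrite -[a]e1 psiM quot_scalM pe mul0r.
Qed.

(** The image of the unit is idempotent, and 0 is the only idempotent scalar of
    modulus less than 1. *)
Lemma quot_scal_idem (A : cstarAlgType R) (e : A) (psi : A -> Q) :
  left_id e (@cmul R A) -> star_hom psi -> `|quot_scal (psi e)| < 1 ->
  quot_scal (psi e) = 0.
Proof.
move=> e1 [_ psiM _]; set t := quot_scal _ => t1.
have tt : t * t = t by rewrite -quot_scalM -psiM e1.
apply/eqP; apply: contraTT t1 => t0.
by rewrite -[t](mulfK t0) tt mulfV// normr1 ltxx.
Qed.

End Quotient.

Lemma quot_scal_map J1 J2 (u : cstar_quot J1^u) : {subset J1 <= J2} ->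
  quot_scal (quot_map J2^u u) = quot_scal u.
Proof.
move=> /unitization_idealS J12; elim/qpiW: u => x.
by rewrite quot_mapE// !quot_scalE.
Qed.

Lemma quot_vec_map J1 J2 (u : cstar_quot J1^u) : {subset J1 <= J2} ->
  quot_vec (quot_map J2^u u) = quot_map J2 (quot_vec u).
Proof.
move=> J12; elim/qpiW: u => x.
by rewrite quot_mapE ?quot_vecE ?quot_mapE//; exact: unitization_idealS.
Qed.

End UnitizationIdeals.

(** * Star homomorphisms and the theorem *)

Lemma star_hom0 (R : realType) (A B : cstarAlgType R) :
  star_hom (fun _ : A => 0 : B).
Proof.
split=> [c a b|a b|a]; first by rewrite scaler0 addr0.
- by rewrite cmul0l.
- by rewrite adj0.
Qed.

Lemma star_hom_comp (R : realType) (A B C : cstarAlgType R)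
    (f : B -> C) (g : A -> B) : star_hom f -> star_hom g -> star_hom (f \o g).
Proof.
move=> [fL fM fA] [gL gM gA]; split=> [c a b|a b|a] /=.
- by rewrite gL fL.
- by rewrite gM fM.
- by rewrite gA fA.
Qed.

Theorem theorem4p15 (R : realType) (A : cstarAlgType R)
    (sepA : separable_space A) (unitA : unital A) :
  WSP1 A <-> WSP A.
Proof.
split=> [wA B sB J Joo JS JE phi phi_hom|wA B sB _]; last exact: wA.
have JJoo n : {subset J n <= Joo}.
  move=> b Jb; have : [set` Joo] b by rewrite JE; apply: subset_closure; exists n.
  by [].
have [e [e1 _]] := unitA.
have [psi [psi_hom psi_cvg]] := wA (unitization B) (separable_unitization sB)
  (unital_unitization B) (fun n => unitization_ideal (J n))
  (unitization_ideal Joo) (fun n => unitization_idealS (JS n))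
  (unitization_ideal_closure JE) _
  (star_hom_comp (quot_inl_star_hom Joo) phi_hom).
(* The scalar part of [psi n e] converges to that of [phi e], which is 0. *)
have psi0 : \forall n \near \oo, quot_scal (psi n e) = 0.
  have : (fun n => quot_scal (psi n e) : R[i]^o) @ \oo --> (0 : R[i]^o).
    under eq_fun do rewrite -(quot_scal_map _ (JJoo _)).
    rewrite -(quot_scal_inl (phi e)).
    exact: (continuous_cvg _ (@quot_scal_continuous _ _ Joo _) (psi_cvg e)).
  move=> /(@cvgr_dist_lt _ _ _ _ _ _ _)/(_ 1 ltr01); apply: filterS => n.
  by rewrite sub0r normrN => /(quot_scal_idem e1 (psi_hom n)).
(* The finitely many [psi n] that leave [B / J n] are replaced by zero. *)
exists (fun n a => if quot_scal (psi n e) == 0 then quot_vec (psi n a) else 0).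
split=> [n|a].
  case: eqP => [pe|_]; last exact: star_hom0.
  apply: quot_vec_star_hom => //; exact: quot_scal_unit pe.
have : (fun n => quot_vec (quot_map (unitization_ideal Joo) (psi n a))) @ \oo
    --> phi a.
  rewrite -[phi a]quot_inlK.
  exact: (continuous_cvg _ (@quot_vec_continuous _ _ Joo _) (psi_cvg a)).
apply: cvg_trans; apply: near_eq_cvg; apply: filterS psi0 => n pe.
by rewrite pe eqxx quot_vec_map.
Qed.
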